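(* Let $(x_1,y_1),\dots,(x_N,y_N)\in\mathbb{R}^2$ be given data points, with associated vectors $P_i\in\mathbb{R}^8$ and matrix $P=(p_{jk})\in\mathbb{R}^{8\times 8}$ (see context). Put $$P_0^{al}=p_{22}\in\mathbb{R},\quad P_1^{al,0}=\begin{pmatrix} p_{23} & p_{26} \end{pmatrix},\quad P_c^0=\begin{pmatrix} p_{33} & p_{36} \\ p_{63} & p_{66} \end{pmatrix},\quad B_c^0=\begin{pmatrix} 0 & -1 \\ -1 & 0 \end{pmatrix},$$ and assume $P_0^{al}\ne 0$. Consider the optimisation problem of minimising $$Q^{al,0}\mapsto\sum_{i=1}^N(P_i\cdot Q^{al,0})^2$$ over all vectors of the form $Q^{al,0}=\begin{pmatrix}0&\bar v^-&\bar v^+&0&0&v^+&0&0\end{pmatrix}^T\in\mathbb{R}^8$ subject to the constraint $(Q^{al,0})^2:=Q^{al,0}\cdot Q^{al,0}=1$. Then the solution is given by $Q^{al,0}=\begin{pmatrix}0&w^{al}&\bar v^+&0&0&v^+&0&0\end{pmatrix}^T$, where $v^0=\begin{pmatrix}\bar v^+&v^+\end{pmatrix}^T\in\mathbb{R}^2$ is an eigenvector, normalised by $(v^0)^TB_c^0v^0=1$, corresponding to the minimal non-negative eigenvalue of $$P_{con}^{al,0}=B_c^0\left(P_c^0-(P_1^{al,0})^T(P_0^{al})^{-1}P_1^{al,0}\right),$$ and $w^{al}=\bar v^-$ is the real number $w^{al}=-(P_0^{al})^{-1}P_1^{al,0}v^0$.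
   Context: On $\mathbb{R}^8$ (the vector space $\mathbb{R}^{5,3}$ underlying Geometric Algebra for Conics, with coordinates ordered as $\bar n_\times,\bar n_-,\bar n_+,e_1,e_2,n_+,n_-,n_\times$) the inner product is $X\cdot Y=X^TBY$, where $B$ is the symmetric $8\times 8$ matrix with $B_{44}=B_{55}=1$, $B_{j,9-j}=-1$ for $j\in\{1,2,3,6,7,8\}$, and all other entries zero. A point $(x_i,y_i)$ is represented by $$P_i=\begin{pmatrix}0&0&1&x_i&y_i&\tfrac12(x_i^2+y_i^2)&\tfrac12(x_i^2-y_i^2)&x_iy_i\end{pmatrix}^T,$$ and $P=\sum_{i=1}^N BP_iP_i^TB$, a symmetric $8\times 8$ matrix, so that $\sum_i(P_i\cdot Q)^2=Q^TPQ$. ''Solution'' of the optimisation problem means a (global) minimiser of the objective function on the set of admissible vectors satisfying the constraint.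
   Formalization: That every solution has the stated form is claimed only if the minimal non-negative eigenvalue has an eigenvector that can be normalised; this is proved when that eigenvalue is positive, and can fail when it is 0, e.g. for the points (1,0),(2,1). *)

(* Defs.v *)
From mathcomp Require Import all_boot all_order all_algebra.
From mathcomp Require Import reals.

Set Implicit Arguments.
Unset Strict Implicit.
Unset Printing Implicit Defensive.

Import Order.TTheory GRing.Theory Num.Theory.
Local Open Scope ring_scope.

Section GAC.
Variable R : realType.

Definition colv n (s : seq R) : 'cV[R]_n := \col_(i < n) s`_i.

Definition mx_of_rows m n (s : seq (seq R)) : 'M[R]_(m, n) :=
  \matrix_(i < m, j < n) (nth [::] s i)`_j.

(* Coordinates are ordered nbar_x, nbar_-, nbar_+, e_1, e_2, n_+, n_-, n_x. *)
Definition Bgac : 'M[R]_8 :=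
  mx_of_rows 8 8
    [:: [::  0;  0;  0; 0; 0;  0;  0; -1];
        [::  0;  0;  0; 0; 0;  0; -1;  0];
        [::  0;  0;  0; 0; 0; -1;  0;  0];
        [::  0;  0;  0; 1; 0;  0;  0;  0];
        [::  0;  0;  0; 0; 1;  0;  0;  0];
        [::  0;  0; -1; 0; 0;  0;  0;  0];
        [::  0; -1;  0; 0; 0;  0;  0;  0];
        [:: -1;  0;  0; 0; 0;  0;  0;  0]].

Definition dotgac (X Y : 'cV[R]_8) : R := (X^T *m Bgac *m Y) 0 0.

Definition point (x y : R) : 'cV[R]_8 :=
  colv 8 [:: 0; 0; 1; x; y; (x ^+ 2 + y ^+ 2) / 2; (x ^+ 2 - y ^+ 2) / 2; x * y].

Definition Pmat N (x y : 'I_N -> R) : 'M[R]_8 :=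
  \sum_(i < N) Bgac *m point (x i) (y i) *m (point (x i) (y i))^T *m Bgac.

(* The entry p_{jk}, with indices j and k counted from 1 to 8. *)
Definition pent (P : 'M[R]_8) (j k : nat) : R := P (inord j.-1) (inord k.-1).

Definition P0al (P : 'M[R]_8) : R := pent P 2 2.

Definition P1al0 (P : 'M[R]_8) : 'rV[R]_2 :=
  mx_of_rows 1 2 [:: [:: pent P 2 3; pent P 2 6]].

Definition Pc0 (P : 'M[R]_8) : 'M[R]_2 :=
  mx_of_rows 2 2 [:: [:: pent P 3 3; pent P 3 6];
                     [:: pent P 6 3; pent P 6 6]].

Definition Bc0 : 'M[R]_2 := mx_of_rows 2 2 [:: [:: 0; -1]; [:: -1; 0]].

Definition Pcon (P : 'M[R]_8) : 'M[R]_2 :=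
  Bc0 *m (Pc0 P - (P0al P)^-1 *: ((P1al0 P)^T *m P1al0 P)).

Definition wal (P : 'M[R]_8) (v0 : 'cV[R]_2) : R :=
  - (P0al P)^-1 * (P1al0 P *m v0) 0 0.

(* [vm] is the nbar_- coordinate; [v0] collects the nbar_+ and n_+ ones. *)
Definition Qal0 (vm : R) (v0 : 'cV[R]_2) : 'cV[R]_8 :=
  colv 8 [:: 0; vm; v0 0 0; 0; 0; v0 1 0; 0; 0].

Definition objective N (x y : 'I_N -> R) (Q : 'cV[R]_8) : R :=
  \sum_(i < N) (dotgac (point (x i) (y i)) Q) ^+ 2.

Definition feasible (Q : 'cV[R]_8) : Prop :=
  (exists vm v0, Q = Qal0 vm v0) /\ dotgac Q Q = 1.

Definition is_solution N (x y : 'I_N -> R) (Q : 'cV[R]_8) : Prop :=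
  feasible Q /\ forall Q', feasible Q' -> objective x y Q <= objective x y Q'.

(* [eigenvalue] is the library's notion, defined through row eigenvectors; a
   square matrix has the same eigenvalues for rows and for columns. *)
Definition min_nonneg_eigenvalue n (A : 'M[R]_n) (lam : R) : Prop :=
  [/\ eigenvalue A lam, 0 <= lam &
      forall mu, eigenvalue A mu -> 0 <= mu -> lam <= mu].

(* The normalisation is a genuine restriction: [Bc0] is indefinite, so an
   eigenvector v with v^T Bc0 v <= 0 has no normalised multiple. *)
Definition normalized_eigenvector (A : 'M[R]_2) (lam : R) (v : 'cV[R]_2) : Prop :=
  [/\ v != 0, A *m v = lam *: v & (v^T *m Bc0 *m v) 0 0 = 1].

End GAC.

(* Main.v *)
Require Import Defs.
From mathcomp Require Import all_boot all_order all_algebra.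
From mathcomp Require Import reals.
From mathcomp Require Import ring lra.
Import Order.TTheory GRing.Theory Num.Theory.
Local Open Scope ring_scope.

(** Write [v] for the pair of coordinates nbar_+ and n_+ of an admissible
    vector, [w] for its nbar_- coordinate and [p] for the entry p_{22}.  The
    objective is the quadratic form of [Pmat], and [p] is nonnegative as a sum
    of squares, hence positive.  Completing the square in [w] ([quad_Qal0])
    gives
      objective = p * (w - wal v)^2 + v^T S v,
    where [S] is the Schur complement of [p] in the 3 x 3 block of the
    admissible coordinates.  The constraint reads v^T Bc0 v = 1 and does not
    involve [w], so a minimiser has w = wal v, and v minimises v^T S v under
    v^T Bc0 v = 1.  Moreover [Pcon] is Bc0 S.

    With S = ((a, b), (b, c)), the eigenvalues of Bc0 S are the roots mu of
    (mu + b)^2 = a c.  The form [S] is positive semidefinite, being the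
    objective at w = wal v, so b^2 <= a c, and m = sqrt a * sqrt c - b is a
    nonnegative eigenvalue.  Everything rests on the identity [quad_split]
      v^T S v = m * v^T Bc0 v + (sqrt a * v_0 + sqrt c * v_1)^2.
    It shows that [m] is a lower bound of v^T S v under the constraint, and
    that the value [m] is taken exactly when the last square vanishes, which
    is the eigenvector equation for [m] ([normalized_top]).

    The minimal nonnegative eigenvalue lam need not be [m]: when b < 0 and
    b^2 = a c, the eigenvalues are lam = 0 and m = -2 b > 0.  But a
    normalised eigenvector for lam has v^T S v = lam, so its existence forces
    m <= lam, hence lam = m ([top_of_normalized]).  If lam > 0, then 0 is not
    an eigenvalue, so b^2 < a c; then lam = m and a normalised eigenvector can
    be written down ([normalized_exists]). *)

(** * Symmetric forms and eigenvalues in dimension two *)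

Definition quad {R : pzRingType} {n} (M : 'M[R]_n) (v : 'cV[R]_n) : R :=
  (v^T *m M *m v) 0 0.

Lemma eigenvalue_det (F : fieldType) n (A : 'M[F]_n) (a : F) :
  eigenvalue A a = (\det (A - a%:M) == 0).
Proof.
by rewrite /eigenvalue /eigenspace kermx_eq0 row_free_unit unitmxE unitfE negbK.
Qed.

Lemma sum2 (R : nmodType) (F : 'I_2 -> R) : \sum_(i < 2) F i = F 0 + F 1.
Proof. by rewrite !big_ord_recl big_ord0 addr0; congr (_ + F _); apply: val_inj. Qed.

Lemma ord2P (P : 'I_2 -> Prop) : P 0 -> P 1 -> forall i, P i.
Proof.
move=> P0 P1; case=> [[|[|//]] i_lt2].
  by rewrite (_ : Ordinal i_lt2 = 0); [|apply: val_inj].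
by rewrite (_ : Ordinal i_lt2 = 1); [|apply: val_inj].
Qed.

Lemma col2P (T : Type) (u v : 'cV[T]_2) : u 0 0 = v 0 0 -> u 1 0 = v 1 0 -> u = v.
Proof. by move=> e0 e1; apply/matrixP=> i j; rewrite [j]ord1; elim/ord2P: i. Qed.

Lemma det2 (R : comPzRingType) (A : 'M[R]_2) :
  \det A = A 0 0 * A 1 1 - A 0 1 * A 1 0.
Proof.
rewrite (expand_det_row _ 0) sum2 /cofactor !det_mx11 !mxE /=.
rewrite (_ : lift 0 0 = 1 :> 'I_2); last exact: val_inj.
rewrite (_ : lift 1 0 = 0 :> 'I_2); last exact: val_inj.
by rewrite expr0 expr1; ring.
Qed.

Lemma quad2E (R : comPzRingType) (S : 'M[R]_2) (v : 'cV[R]_2) : S^T = S ->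
  quad S v = S 0 0 * v 0 0 ^+ 2 + S 0 1 * v 0 0 * v 1 0 *+ 2 + S 1 1 * v 1 0 ^+ 2.
Proof.
move=> /matrixP/(_ 0 1); rewrite mxE => S10.
by rewrite /quad mxE sum2 !mxE !sum2 !mxE S10; ring.
Qed.

Lemma quad_Bc0 (R : realType) (v : 'cV[R]_2) : quad (Bc0 R) v = - (v 0 0 * v 1 0) *+ 2.
Proof. by rewrite /quad mxE sum2 !mxE !sum2 !mxE /=; ring. Qed.

Lemma Bc0_invol (R : realType) : Bc0 R *m Bc0 R = 1%:M.
Proof.
by apply/matrixP=> i j; rewrite !mxE sum2 !mxE; elim/ord2P: i; elim/ord2P: j => /=; ring.
Qed.

(** * Minimising a semidefinite form on a hyperbola *)

Section Psd.
Context {R : realType} (S : 'M[R]_2) (symS : S^T = S).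
Context (psdS : forall v, 0 <= quad S v).

Lemma symS10 : S 1 0 = S 0 1.
Proof. by move/matrixP: symS => /(_ 0 1); rewrite mxE. Qed.

Lemma Bc0_mulE (v : 'cV[R]_2) :
  ((Bc0 R *m S *m v) 0 0 = - (S 0 1 * v 0 0 + S 1 1 * v 1 0)) *
  ((Bc0 R *m S *m v) 1 0 = - (S 0 0 * v 0 0 + S 0 1 * v 1 0)).
Proof. by rewrite !mxE !sum2 !mxE !sum2 !mxE /= symS10; split; ring. Qed.

Lemma eigenvalue_Bc0 (mu : R) :
  eigenvalue (Bc0 R *m S) mu = ((mu + S 0 1) ^+ 2 == S 0 0 * S 1 1).
Proof.
rewrite eigenvalue_det det2 !mxE !sum2 !mxE /= symS10 -[RHS]subr_eq0.
by congr (_ == 0); ring.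
Qed.

(** Since [Bc0] is its own inverse, S v = mu * Bc0 v; pair this with [v]. *)
Lemma eigenvector_quad (mu : R) (v : 'cV[R]_2) :
  Bc0 R *m S *m v = mu *: v -> quad S v = mu * quad (Bc0 R) v.
Proof.
move=> Sv; rewrite /quad.
have -> : v^T *m S *m v = v^T *m Bc0 R *m (Bc0 R *m S *m v).
  by rewrite !mulmxA -(mulmxA v^T (Bc0 R)) Bc0_invol mulmx1.
by rewrite Sv -scalemxAr mxE.
Qed.

Lemma psd_diag_ge0 : 0 <= S 0 0 /\ 0 <= S 1 1.
Proof.
by split; [have := psdS (delta_mx 0 0) | have := psdS (delta_mx 1 0)];
   rewrite quad2E // !mxE /=; lra.
Qed.

Lemma psd_det_ge0 : S 0 1 ^+ 2 <= S 0 0 * S 1 1.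
Proof.
have [S00_ge0 S11_ge0] := psd_diag_ge0.
(* At (b, -a) the form takes the value a * (a c - b^2), which settles a > 0;
   at (c + 1, -b) with a = 0 it takes the value - (c + 2) * b^2. *)
have := psdS (colv 2 [:: S 0 1; - S 0 0]).
have := psdS (colv 2 [:: S 1 1 + 1; - S 0 1]).
rewrite !quad2E // !mxE /=.
move: S00_ge0 S11_ge0; set a := S 0 0; set b := S 0 1; set c := S 1 1.
rewrite le0r => /predU1P[->|a_gt0] c_ge0 q1 q2; first by nra.
rewrite -subr_ge0 -(pmulr_rge0 _ a_gt0).
by apply: le_trans q2 _; rewrite le_eqVlt; apply/orP; left; apply/eqP; ring.
Qed.

(** The larger root of (mu + S 0 1)^2 = S 0 0 * S 1 1, with the square root of
    the product split so that [quad_split] is a polynomial identity in the two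
    roots. *)
Definition top_eigenvalue : R := Num.sqrt (S 0 0) * Num.sqrt (S 1 1) - S 0 1.

Lemma top_eigenvalueP :
  eigenvalue (Bc0 R *m S) top_eigenvalue /\ 0 <= top_eigenvalue.
Proof.
have [S00_ge0 S11_ge0] := psd_diag_ge0; split.
  by rewrite eigenvalue_Bc0 subrK exprMn !sqr_sqrtr.
rewrite subr_ge0 -sqrtrM //; apply: le_trans (ler_norm _) _.
by rewrite -sqrtr_sqr ler_wsqrtr // psd_det_ge0.
Qed.

(** The cross term 2 sqrt(S 0 0) sqrt(S 1 1) v_0 v_1 of the square is
    - sqrt(S 0 0) sqrt(S 1 1) times v^T Bc0 v = - 2 v_0 v_1: adding a multiple
    of the constraint turns [S] into a perfect square. *)
Lemma quad_split (v : 'cV[R]_2) :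
  quad S v = top_eigenvalue * quad (Bc0 R) v
             + (Num.sqrt (S 0 0) * v 0 0 + Num.sqrt (S 1 1) * v 1 0) ^+ 2.
Proof.
have [S00_ge0 S11_ge0] := psd_diag_ge0.
rewrite quad2E // quad_Bc0 /top_eigenvalue.
rewrite -[in LHS](sqr_sqrtr S00_ge0) -[in LHS](sqr_sqrtr S11_ge0); ring.
Qed.

Lemma top_eigenvalue_lb (v : 'cV[R]_2) :
  quad (Bc0 R) v = 1 -> top_eigenvalue <= quad S v.
Proof. by move=> Bv; rewrite quad_split Bv mulr1 lerDl sqr_ge0. Qed.

Lemma min_nonneg_eigenvalue_Bc0 :
  exists lam, min_nonneg_eigenvalue (Bc0 R *m S) lam.
Proof.
have [eig_top top_ge0] := top_eigenvalueP.
have [S00_ge0 S11_ge0] := psd_diag_ge0.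
pose r := Num.sqrt (S 0 0) * Num.sqrt (S 1 1).
have eigE mu : eigenvalue (Bc0 R *m S) mu = (mu == r - S 0 1) || (mu == - r - S 0 1).
  rewrite eigenvalue_Bc0 -[S 0 0 in LHS]sqr_sqrtr // -[S 1 1 in LHS]sqr_sqrtr //.
  by rewrite -exprMn eqf_sqr !(eq_sym mu) !subr_eq !(eq_sym _ (mu + _)).
have r_ge0 : 0 <= r by rewrite mulr_ge0 ?sqrtr_ge0.
(* If the lower eigenvalue is nonnegative it is the minimum; this happens when
   the determinant vanishes and S 0 1 <= 0.  Otherwise the top one is. *)
have [low_ge0|low_lt0] := leP 0 (- r - S 0 1).
  exists (- r - S 0 1); split=> //; first by rewrite eigE eqxx orbT.
  by move=> mu; rewrite eigE => /orP[]/eqP->; lra.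
exists top_eigenvalue; split=> // mu.
by rewrite eigE /top_eigenvalue -/r => /orP[]/eqP->; lra.
Qed.

(** A normalised eigenvector for lam takes the value lam on the constraint set,
    where [S] is at least [top_eigenvalue]; minimality of lam gives the
    converse inequality. *)
Lemma top_of_normalized lam (v : 'cV[R]_2) :
  min_nonneg_eigenvalue (Bc0 R *m S) lam ->
  normalized_eigenvector (Bc0 R *m S) lam v -> lam = top_eigenvalue.
Proof.
have [eig_top top_ge0] := top_eigenvalueP.
move=> [_ _ lam_min] [_ Sv Bv]; apply/eqP; rewrite eq_le lam_min //=.
by rewrite -[lam]mulr1 -Bv -eigenvector_quad ?top_eigenvalue_lb.
Qed.

(** The normalised eigenvectors for [top_eigenvalue] are the minimisers of [S]
    on the constraint set: the square in [quad_split] vanishes there, and each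
    row of the eigenvector equation is the base of that square times
    - sqrt(S 1 1) or - sqrt(S 0 0). *)
Lemma normalized_top (v : 'cV[R]_2) :
  normalized_eigenvector (Bc0 R *m S) top_eigenvalue v <->
  quad (Bc0 R) v = 1 /\ quad S v = top_eigenvalue.
Proof.
split=> [[_ Sv Bv]|[Bv qv]].
  by split=> //; rewrite (eigenvector_quad _ _ Sv) [quad _ _]Bv mulr1.
have [S00_ge0 S11_ge0] := psd_diag_ge0.
have /eqP : (Num.sqrt (S 0 0) * v 0 0 + Num.sqrt (S 1 1) * v 1 0) ^+ 2 = 0.
  by move: qv; rewrite quad_split Bv mulr1 => /eqP; rewrite -subr_eq0 addrC addKr => /eqP.
rewrite sqrf_eq0 => /eqP root0.
split=> //.
  by apply: contra_eq_neq Bv => ->; rewrite quad_Bc0 mxE mul0r oppr0 mul0rn eq_sym oner_neq0.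
apply: col2P; rewrite Bc0_mulE mxE /top_eigenvalue.
  rewrite -{1}(sqr_sqrtr S11_ge0).
  apply/eqP; rewrite -subr_eq0; apply/eqP.
  by rewrite -(mulr0 (- Num.sqrt (S 1 1))) -root0; ring.
rewrite -{1}(sqr_sqrtr S00_ge0).
apply/eqP; rewrite -subr_eq0; apply/eqP.
by rewrite -(mulr0 (- Num.sqrt (S 0 0))) -root0; ring.
Qed.

(** Positivity of lam excludes the eigenvalue 0, so [S] is definite and the line
    sqrt(S 0 0) v_0 + sqrt(S 1 1) v_1 = 0 has v_0 v_1 < 0 off the origin: it
    meets the hyperbola - 2 v_0 v_1 = 1. *)
Lemma normalized_exists lam :
  min_nonneg_eigenvalue (Bc0 R *m S) lam -> 0 < lam ->
  exists v, normalized_eigenvector (Bc0 R *m S) lam v.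
Proof.
move=> [eig_lam _ lam_min] lam_gt0.
have [S00_ge0 S11_ge0] := psd_diag_ge0.
have [eig_top top_ge0] := top_eigenvalueP.
have det_gt0 : S 0 1 ^+ 2 < S 0 0 * S 1 1.
  rewrite lt_neqAle psd_det_ge0 andbT; apply: contraTneq lam_gt0 => det0.
  by rewrite -leNgt lam_min // eigenvalue_Bc0 add0r det0.
have lamE : lam = top_eigenvalue.
  have : (lam + S 0 1) ^+ 2 == (Num.sqrt (S 0 0) * Num.sqrt (S 1 1)) ^+ 2.
    by rewrite exprMn !sqr_sqrtr // -eigenvalue_Bc0.
  rewrite eqf_sqr /top_eigenvalue => /orP[]/eqP eq_lam; first by rewrite -eq_lam addrK.
  (* The lower root is negative when the determinant of S is positive. *)
  have := top_ge0; rewrite /top_eigenvalue.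
  set r := _ * _ in eq_lam *.
  have r_ge0 : 0 <= r by rewrite mulr_ge0 ?sqrtr_ge0.
  move: det_gt0; rewrite -[S 0 0]sqr_sqrtr // -[S 1 1]sqr_sqrtr // -exprMn -/r.
  by nra.
have diag_gt0 : 0 < S 0 0 * S 1 1 by apply: le_lt_trans det_gt0; apply: sqr_ge0.
have [S00_gt0 S11_gt0] : 0 < S 0 0 /\ 0 < S 1 1 by split; nra.
pose r := Num.sqrt (S 0 0); pose s := Num.sqrt (S 1 1).
have r_gt0 : 0 < r by rewrite sqrtr_gt0.
have s_gt0 : 0 < s by rewrite sqrtr_gt0.
(* The scale t makes - 2 v_0 v_1 = 2 r s t^2 equal to 1. *)
pose t := (Num.sqrt (2 * r * s))^-1.
have t2 : t ^+ 2 = (2 * r * s)^-1.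
  by rewrite exprVn sqr_sqrtr // !mulr_ge0 // ltW.
pose v : 'cV[R]_2 := colv 2 [:: t * s; - (t * r)].
have Bv : quad (Bc0 R) v = 1.
  rewrite quad_Bc0 !mxE /=.
  have -> : - (t * s * - (t * r)) *+ 2 = 2 * r * s * t ^+ 2 by ring.
  by rewrite t2 mulfV // !mulf_neq0 // ?lt0r_neq0.
exists v; rewrite lamE; apply/normalized_top; split=> //.
rewrite quad_split Bv !mxE /= -/r -/s; ring.
Qed.

End Psd.

(** * Completing the square *)

(** [Pcon P] is [Bc0 *m schur P]. *)
Definition schur {R : realType} (P : 'M[R]_8) : 'M[R]_2 :=
  Pc0 P - (P0al P)^-1 *: ((P1al0 P)^T *m P1al0 P).

Lemma Bgac_sym (R : realType) : (Bgac R)^T = Bgac R.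
Proof.
apply/matrixP=> i j; rewrite !mxE.
by case: i => [[|[|[|[|[|[|[|[|//]]]]]]]] ?]; case: j => [[|[|[|[|[|[|[|[|//]]]]]]]] ?].
Qed.

(** Each summand is the square of the scalar p^T B Q, and a scalar equals its
    transpose. *)
Lemma objectiveE (R : realType) N (x y : 'I_N -> R) Q :
  objective x y Q = quad (Pmat x y) Q.
Proof.
rewrite /objective /quad /Pmat mulmx_sumr mulmx_suml summxE; apply: eq_bigr => i _.
rewrite /dotgac; set p := point _ _.
have -> : Q^T *m (Bgac R *m p *m p^T *m Bgac R) *m Q
          = (p^T *m Bgac R *m Q)^T *m (p^T *m Bgac R *m Q).
  by rewrite !trmx_mul trmxK Bgac_sym !mulmxA.
by move: (_ *m Q) => m; rewrite [RHS]mxE big_ord1 [m^T _ _]mxE expr2.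
Qed.

Lemma Pmat_sym (R : realType) N (x y : 'I_N -> R) : (Pmat x y)^T = Pmat x y.
Proof.
rewrite /Pmat linear_sum; apply: eq_bigr => i _.
by rewrite /= !trmx_mul trmxK Bgac_sym !mulmxA.
Qed.

Lemma sum_Qal0 (R : realType) (w : R) v (F : 'I_8 -> R) :
  \sum_j Qal0 w v j 0 * F j
  = w * F (inord 1) + v 0 0 * F (inord 2) + v 1 0 * F (inord 5).
Proof.
rewrite !big_ord_recl big_ord0 !mxE /= !mul0r !add0r !addr0 !addrA.
by congr (_ * F _ + _ * F _ + _ * F _); apply: val_inj; rewrite /= inordK.
Qed.

Lemma Qal0_pairing (R : realType) (w : R) v (u : 'cV[R]_8) :
  ((Qal0 w v)^T *m u) 0 0
  = w * u (inord 1) 0 + v 0 0 * u (inord 2) 0 + v 1 0 * u (inord 5) 0.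
Proof. by rewrite -(sum_Qal0 _ _ _ (u^~ 0)) mxE; apply: eq_bigr => j _; rewrite mxE. Qed.

Lemma dotgac_Qal0 (R : realType) (w : R) v :
  dotgac (Qal0 w v) (Qal0 w v) = quad (Bc0 R) v.
Proof.
rewrite /dotgac -mulmxA Qal0_pairing !mxE !big_ord_recl !big_ord0 quad_Bc0 !mxE !inordK //=; ring.
Qed.

Lemma schur_sym (R : realType) (P : 'M[R]_8) : P^T = P -> (schur P)^T = schur P.
Proof.
move=> symP; rewrite /schur linearB linearZ /= trmx_mul trmxK; congr (_ - _).
have symE j k : P j k = P k j by rewrite -{1}symP mxE.
by apply/matrixP=> i j; rewrite !mxE; elim/ord2P: i; elim/ord2P: j => //=; apply: symE.
Qed.

(** Completing the square in [w]: [wal P v] is the minimiser in [w] for fixed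
    [v], and what remains is the Schur complement of the entry p_{22}. *)
Lemma quad_Qal0 (R : realType) (P : 'M[R]_8) (w : R) v :
  P^T = P -> P0al P != 0 ->
  quad P (Qal0 w v) = P0al P * (w - wal P v) ^+ 2 + quad (schur P) v.
Proof.
move=> symP P0_neq0; rewrite (quad2E _ _ _ (schur_sym _ _ symP)) /wal.
rewrite /quad -mulmxA Qal0_pairing.
have symE j k : P j k = P k j by rewrite -{1}symP mxE.
have PQ k : (P *m Qal0 w v) k 0
    = w * P k (inord 1) + v 0 0 * P k (inord 2) + v 1 0 * P k (inord 5).
  by rewrite mxE -sum_Qal0; apply: eq_bigr => j _; rewrite mulrC.
rewrite !PQ /schur !mxE !sum2 !big_ord1 !mxE /= /pent /=.
rewrite (symE (inord 2) (inord 1)) (symE (inord 5)) (symE (inord 5) (inord 2)).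
move: P0_neq0; rewrite /P0al /pent /=; set p := P _ _ => p_neq0.
by field.
Qed.

Theorem proposition6 (R : realType) (N : nat) (x y : 'I_N -> R)
    (hP0 : P0al (Pmat x y) != 0) :
  exists lam : R,
    [/\ min_nonneg_eigenvalue (Pcon (Pmat x y)) lam,
        (forall v0 : 'cV[R]_2,
           normalized_eigenvector (Pcon (Pmat x y)) lam v0 ->
           is_solution x y (Qal0 (wal (Pmat x y) v0) v0)),
        ((exists v0 : 'cV[R]_2,
            normalized_eigenvector (Pcon (Pmat x y)) lam v0) ->
         forall Q : 'cV[R]_8, is_solution x y Q ->
           exists v0 : 'cV[R]_2,
             normalized_eigenvector (Pcon (Pmat x y)) lam v0 /\
             Q = Qal0 (wal (Pmat x y) v0) v0) &
        (0 < lam -> exists v0 : 'cV[R]_2,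
            normalized_eigenvector (Pcon (Pmat x y)) lam v0)].
Proof.
have symP := Pmat_sym _ _ x y.
set P := Pmat x y in hP0 symP *; pose S := schur P.
rewrite -[Pcon P]/(Bc0 R *m S).
have symS : S^T = S by apply: schur_sym.
have objE w v : objective x y (Qal0 w v) = P0al P * (w - wal P v) ^+ 2 + quad S v.
  by rewrite objectiveE quad_Qal0.
have obj_ge0 Q : 0 <= objective x y Q by apply: sumr_ge0 => i _; apply: sqr_ge0.
have psdS v : 0 <= quad S v.
  by have := obj_ge0 (Qal0 (wal P v) v); rewrite objE subrr expr0n mulr0 add0r.
have P0_gt0 : 0 < P0al P.
  rewrite lt0r hP0 /=; have := obj_ge0 (Qal0 1 0).
  by rewrite objE /wal /quad !mulmx0 !mxE mulr0 subr0 expr1n mulr1 addr0.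
have top_lb w v : feasible (Qal0 w v) -> top_eigenvalue S <= objective x y (Qal0 w v).
  rewrite objE => -[_]; rewrite dotgac_Qal0 => Bv.
  apply: le_trans (top_eigenvalue_lb S symS psdS v Bv) _.
  by rewrite lerDr mulr_ge0 ?sqr_ge0 // ltW.
have [lam lam_min] := min_nonneg_eigenvalue_Bc0 S symS psdS.
have attained v : normalized_eigenvector (Bc0 R *m S) lam v ->
    feasible (Qal0 (wal P v) v) /\ objective x y (Qal0 (wal P v) v) = top_eigenvalue S.
  move=> eig_v; have lamE := top_of_normalized S symS psdS _ _ lam_min eig_v.
  move: eig_v; rewrite lamE => /(normalized_top S symS psdS)[Bv Sv].
  split; first by split; [exists (wal P v), v | rewrite dotgac_Qal0].
  by rewrite objE subrr expr0n mulr0 add0r.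
exists lam; split=> //.
- move=> v /attained[feas_v obj_v]; split=> // Q' feas_Q'.
  have [[w' [v' Q'E]] _] := feas_Q'; rewrite obj_v Q'E; apply: top_lb.
  by rewrite -Q'E.
- move=> [u eig_u] Q [feas_Q Q_min].
  have [feas_u obj_u] := attained _ eig_u.
  have [[w [v QE]] Bv] := feas_Q; rewrite QE dotgac_Qal0 in Bv.
  have := Q_min _ feas_u; rewrite obj_u QE objE => obj_le.
  have Sv_ge := top_eigenvalue_lb S symS psdS v Bv.
  have sq_ge0 : 0 <= P0al P * (w - wal P v) ^+ 2 by rewrite mulr_ge0 ?sqr_ge0 // ltW.
  have Sv : quad S v = top_eigenvalue S by lra.
  have /eqP : P0al P * (w - wal P v) ^+ 2 = 0 by lra.
  rewrite mulf_eq0 (negPf hP0) sqrf_eq0 subr_eq0 => /eqP wE.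
  exists v; split; last by rewrite wE.
  rewrite (top_of_normalized S symS psdS _ _ lam_min eig_u).
  exact/(normalized_top S symS psdS).
- exact: normalized_exists.
Qed.
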